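(* Let $G$ be a finite graph. The $\mathcal{F}$-depth of $G$ is infinite if and only if $G$ is $K_1$ or $K_3$.
   Context: All graphs are simple (no loops or multiple edges), labeled, and may be finite or infinite. A forest of $H$ is an acyclic subgraph; a maximal forest is a forest of $H$ not properly contained in another forest of $H$. The forest graph $\mathcal{F}(H)$ has as vertices the maximal forests of $H$, two being adjacent iff $F_2=F_1-e+f$ for some edges $e\in F_1$, $f\notin F_1$. $\mathcal{F}^0(H)=H$, $\mathcal{F}^n(H)=\mathcal{F}(\mathcal{F}^{n-1}(H))$. A graph $H$ is an $\mathcal{F}$-root of $G$ if $\mathcal{F}(H)\cong G$. The $\mathcal{F}$-depth of $G$ is $\sup\{n\in\mathbb{N}: G\cong\mathcal{F}^n(H)\text{ for some graph }H\}$, and is defined to be $0$ if $G$ has no $\mathcal{F}$-root. *)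

(* Defs.v *)
From mathcomp Require Import all_boot all_order all_algebra.
From mathcomp Require Import boolp classical_sets functions cardinality.
From mathcomp Require Import constructive_ereal.

Set Implicit Arguments.
Unset Strict Implicit.
Unset Printing Implicit Defensive.

Local Open Scope classical_set_scope.

Record graph := Graph {
  vertex :> Type;
  adj : vertex -> vertex -> Prop;
  adj_sym : forall x y, adj x y -> adj y x;
  adj_irr : forall x, ~ adj x x
}.

Definition isomorphic (G H : graph) : Prop :=
  exists f : G -> H, bijective f /\ forall x y, adj x y <-> adj (f x) (f y).

Definition finite_graph (G : graph) : Prop := finite_set [set: G].

Definition edges (G : graph) : set (set G) :=
  [set e | exists x y : G, adj x y /\ e = [set x; y]].
Arguments edges : clear implicits.

Record subgraph (H : graph) := Subgraph {
  sub_vertices : set H;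
  sub_edges : set (set H);
  sub_edgesP : sub_edges `<=` edges H;
  sub_edges_vertices : forall e, sub_edges e -> e `<=` sub_vertices
}.

Definition subgraph_le (H : graph) (S T : subgraph H) : Prop :=
  sub_vertices S `<=` sub_vertices T /\ sub_edges S `<=` sub_edges T.

(* [ordS] is the cyclic successor on ['I_k], so [v] lists the vertices of a
   cycle of length [n + 3] in order. *)
Definition acyclic (H : graph) (S : subgraph H) : Prop :=
  ~ exists (n : nat) (v : 'I_n.+3 -> H),
      injective v /\ forall i, sub_edges S [set v i; v (ordS i)].

Definition maximal_forest (H : graph) (F : subgraph H) : Prop :=
  acyclic F /\ forall F', acyclic F' -> subgraph_le F F' -> F' = F.

Definition forest_exchange (H : graph) (F1 F2 : subgraph H) : Prop :=
  exists e f, [/\ sub_edges F1 e, ~ sub_edges F1 f,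
    sub_vertices F2 = sub_vertices F1 &
    sub_edges F2 = (sub_edges F1 `\ e) `|` [set f]].

Lemma forest_exchange_sym (H : graph) (F1 F2 : subgraph H) :
  forest_exchange F1 F2 -> forest_exchange F2 F1.
Proof.
move=> [e [f [F1e F1f Ev Ee]]]; exists f, e; split; rewrite ?Ev ?Ee //.
- by right.
- by case=> [[_ /(_ erefl)]//|ef]; apply: F1f; rewrite -[f]ef.
- apply/seteqP; split=> g /=.
  + move=> F1g; have [->|ge] := pselect (g = e); first by right.
    left; split; first by left.
    by move=> gf; apply: F1f; rewrite -gf.
  + by move=> [[[[]//|gf] ngf]|->].
Qed.

Lemma forest_exchange_irr (H : graph) (F : subgraph H) : ~ forest_exchange F F.
Proof. by move=> [e [f [_ Ff _ Ee]]]; apply: Ff; rewrite Ee; right. Qed.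

Definition forest_graph (H : graph) : graph := {|
  vertex := {F : subgraph H | maximal_forest F};
  adj := fun F1 F2 => forest_exchange (sval F1) (sval F2);
  adj_sym := fun F1 F2 => @forest_exchange_sym H (sval F1) (sval F2);
  adj_irr := fun F => @forest_exchange_irr H (sval F)
|}.

Definition forest_iter (n : nat) (H : graph) : graph := iter n forest_graph H.

Definition F_root (G H : graph) : Prop := isomorphic (forest_graph H) G.

(* The supremum is taken among the integers extended with [-oo] and [+oo],
   where every nonempty set of natural numbers has one. The set below always
   contains 0, as [forest_iter 0 G] is [G], so the default value of
   [supremum] on the empty set is irrelevant. *)
Definition F_depth (G : graph) : \bar int :=
  if `[< exists H, F_root G H >]
  then supremum 0%E [set (Posz n)%:E | n in
         [set n | exists H, isomorphic G (forest_iter n H)]]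
  else 0%E.

Definition complete_graph (n : nat) : graph := {|
  vertex := 'I_n;
  adj := fun i j => i <> j;
  adj_sym := fun i j ne e => ne (esym e);
  adj_irr := fun i ne => ne erefl
|}.

(* Main.v *)
(** In a forest graph [F(H)], a maximal forest [T] and an edge [f] outside it
    give a triangle through [T], spanned by [T + f - e] and [T + f - e'] for two
    edges [e], [e'] of the cycle of [T + f]. If every maximal forest of [X]
    misses at least [k >= 2] edges, then [F(X)] contains [k + 1] edge-disjoint
    triangles, so every maximal forest of [F(X)] misses at least [k + 1] edges.
    If [H] has no cycle, or a single cycle of length 3, then [F(H)] is [K_1] or
    [K_3]; otherwise every maximal forest of [F(H)] misses at least 2 edges, and
    the number of missed edges, hence of vertices, of [F^n(H)] grows with [n]. *)

Require Import Defs.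
From mathcomp Require Import constructive_ereal.
From mathcomp Require Import all_boot all_order all_algebra.
From mathcomp Require Import boolp classical_sets functions cardinality.

Set Implicit Arguments.
Unset Strict Implicit.
Unset Printing Implicit Defensive.

Local Open Scope classical_set_scope.

(** * Connectivity and forests as edge sets *)

Lemma set2_eq (V : Type) (a b c d : V) : [set a; b] = [set c; d] ->
  (a = c /\ b = d) \/ (a = d /\ b = c).
Proof.
move=> E.
have Ha : [set c; d] a by rewrite -E; left.
have Hb : [set c; d] b by rewrite -E; right.
have Hc : [set a; b] c by rewrite E; left.
have Hd : [set a; b] d by rewrite E; right.
by case: Ha Hb Hc Hd => /= ? [] /= ? [] /= ? [] /= ?; subst; auto.
Qed.

Inductive conn (V : Type) (A : set (set V)) (x : V) : V -> Prop :=
| conn0 : conn A x x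
| connS y z : conn A x y -> A [set y; z] -> conn A x z.

(** Acyclicity in the form that every edge is a bridge: no cycle has to be exhibited, and proofs go
    by induction on [conn]. *)
Definition forest (V : Type) (A : set (set V)) : Prop :=
  forall x y, A [set x; y] -> ~ conn (A `\ [set x; y]) x y.

Arguments connS {V A x y z}.

Section Connectivity.
Variable V : Type.
Implicit Types (A B : set (set V)) (x y z : V).

Lemma conn1 A x y : A [set x; y] -> conn A x y.
Proof. by move=> xy; exact: connS (conn0 A x) xy. Qed.

Lemma conn_trans A x y z : conn A x y -> conn A y z -> conn A x z.
Proof. by move=> xy; elim=> // t u _ c tu; exact: (connS c tu). Qed.

Lemma conn_sym A x y : conn A x y -> conn A y x.
Proof.
elim=> [|t u _ tx tu]; first exact: conn0.
by apply: conn_trans tx; apply: conn1; rewrite setUC.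
Qed.

Lemma conn_bind A B x y :
  (forall a b, A [set a; b] -> conn B a b) -> conn A x y -> conn B x y.
Proof.
move=> AB; elim=> [|t u _ xt /AB tu]; first exact: conn0.
exact: conn_trans tu.
Qed.

Lemma conn_sub A B x y : A `<=` B -> conn A x y -> conn B x y.
Proof. by move=> AB; apply: conn_bind => a b /AB; exact: conn1. Qed.

(** A walk can be shortened until it crosses the new edge at most once; the last two cases are the
    two directions of crossing. *)
Lemma conn_add A x y a b : conn (A `|` [set [set x; y]]) a b ->
  [\/ conn A a b, conn A a x /\ conn A y b | conn A a y /\ conn A x b].
Proof.
elim=> [|t u _ IH [tu|]]; first by constructor 1; exact: conn0.
- case: IH => [c|[? c]|[? c]]; [constructor 1|constructor 2|constructor 3].
  + exact: (connS c tu).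
  + by split=> //; exact: (connS c tu).
  + by split=> //; exact: (connS c tu).
- move=> E; case: (set2_eq E) => -[? ?]; subst.
  + case: IH => [at_|[? ?]|[? ?]].
    * by constructor 2; split=> //; exact: conn0.
    * by constructor 2; split=> //; exact: conn0.
    * by constructor 1.
  + case: IH => [at_|[? ?]|[? ?]].
    * by constructor 3; split=> //; exact: conn0.
    * by constructor 1.
    * by constructor 3; split=> //; exact: conn0.
Qed.

Lemma forest_sub A B : A `<=` B -> forest B -> forest A.
Proof.
move=> AB fB x y /AB/fB nc c; apply: nc; apply: conn_sub c => g [/AB].
by split.
Qed.

(** A detour around an old edge [[set a; b]] must cross the new edge, as [A] is a forest; its two
    halves and [[set a; b]] itself would then connect [x] to [y] in [A]. *)
Lemma forest_add A x y :
  forest A -> ~ conn A x y -> forest (A `|` [set [set x; y]]).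
Proof.
move=> fA nxy a b Aab.
have [E c|ne] := pselect ([set a; b] = [set x; y]).
  have {}c : conn A a b by apply: conn_sub c => g [[]// -> []].
  by case: (set2_eq E) => [] [? ?]; subst; [|move/conn_sym in c]; exact: nxy.
have {Aab} Aab : A [set a; b] by case: Aab.
move=> c; have /conn_add : conn ((A `\ [set a; b]) `|` [set [set x; y]]) a b.
  by apply: conn_sub c => g [[Ag|->] gab]; [left|right].
have sA : A `\ [set a; b] `<=` A by move=> g [].
case=> [/(fA _ _ Aab)//|[/(conn_sub sA) ax /(conn_sub sA) yb]|
   [/(conn_sub sA) ay /(conn_sub sA) xb]]; apply: nxy.
  apply: conn_trans (conn_sym ax) _.
  exact: conn_trans (conn1 Aab) (conn_sym yb).
apply: conn_trans xb _; apply: conn_trans ay.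
exact: conn_sym (conn1 Aab).
Qed.

(* The first edge of the simple path from [x] to [y]. *)
Lemma forest_first_edge A x y : forest A -> conn A x y -> x <> y ->
  exists2 z, A [set x; z] & ~ conn (A `\ [set x; z]) x y.
Proof.
move=> fA; elim=> // t u xt IH tu xu.
have [xt_eq|nxt] := pselect (x = t).
  by subst t; exists u => //; exact: fA.
have [z Axz nc] := IH nxt; exists z => // c; apply: nc.
apply: (connS c); split; first by rewrite setUC.
by move=> E; case: (set2_eq E) => -[] // uz tx; [apply: xu|apply: nxt].
Qed.

(** Take the first edge of the path from each of its two ends. They could coincide only if the path
    were the single edge [[set x; y]]. *)
Lemma forest_two_edges A x y : forest A -> conn A x y -> x <> y ->
  ~ A [set x; y] ->
  exists e e', [/\ e <> e', A e, A e', ~ conn (A `\ e) x y &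
    ~ conn (A `\ e') x y].
Proof.
move=> fA c xy nA.
have [z Axz nz] := forest_first_edge fA c xy.
have yx : y <> x by move=> E; apply: xy.
have [w Ayw nw] := forest_first_edge fA (conn_sym c) yx.
exists [set x; z], [set y; w]; split=> //.
- by move=> E; case: (set2_eq E) => -[] // _ zy; subst z.
- by move=> /conn_sym.
Qed.

End Connectivity.

(** * Bridges versus cycles *)

Lemma edgesP (H : graph) (x y : H) : edges H [set x; y] <-> adj x y.
Proof.
split=> [[a [b [ab E]]]|xy]; last by exists x, y.
by case: (set2_eq E) => -[-> ->] //; exact: adj_sym.
Qed.

Lemma forest_acyclic (H : graph) (S : subgraph H) :
  forest (sub_edges S) -> acyclic S.
Proof.
move=> fS [n [v [vI vS]]].
pose m : 'I_n.+3 := ord_max.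
have Sm : ordS m = ord0 by apply: val_inj; rewrite /= modnn.
have := vS m; rewrite Sm => Sm0.
apply: (fS _ _ Sm0); apply: conn_sym.
suff c k (kn : (k < n.+3)%N) :
    conn (sub_edges S `\ [set v m; v ord0]) (v ord0) (v (Ordinal kn)).
  have -> : m = Ordinal (ltnSn n.+2) by exact: val_inj.
  exact: c.
elim: k kn => [|k IH] kn.
  have -> : Ordinal kn = ord0 by exact: val_inj.
  exact: conn0.
have kn' : (k < n.+3)%N by exact: ltnW.
apply: (connS (IH kn')).
have Sk : ordS (Ordinal kn') = Ordinal kn.
  by apply: val_inj; rewrite /= modn_small.
split; first by rewrite -Sk.
(* A step of the walk equal to the closing edge would force either a step from the last index to 0,
   or [n.+2 = 1]; this is where the cycle length of at least 3 enters. *)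
move=> E.
case: (set2_eq E) => -[/vI/(congr1 val)/= E1 /vI/(congr1 val)/= E2] //.
by rewrite E1 in E2.
Qed.

Lemma conn_path (V : Type) (A : set (set V)) (x y : V) : conn A x y ->
  exists2 p, path (fun a b => `[< A [set a; b] >]) x p & last x p = y.
Proof.
elim=> [|t u _ [p pA <-] tu]; first by exists [::].
exists (rcons p u); last by rewrite last_rcons.
by rewrite rcons_path pA; apply/asboolP.
Qed.

Lemma acyclic_forest (H : graph) (S : subgraph H) :
  acyclic S -> forest (sub_edges S).
Proof.
move=> aS x y Sxy c; have [p0 pA ly] := conn_path c; apply: aS.
have xy : x <> y.
  move=> xy; have /edgesP := sub_edgesP Sxy; rewrite xy; exact: adj_irr.
(* Shortening a walk to a simple path needs decidable equality, supplied classically. *)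
pose E := {classic H}.
have [p [q upq lp]] : exists p : seq E, [/\ path (fun a b : E =>
    `[< (sub_edges S `\ [set x; y]) [set a; b] >]) x p,
    uniq ((x : E) :: p) & last (x : E) p = y].
  case/(@shortenP E) : pA ly => p' q u _ l; by exists p'.
(* The path avoids [[set x; y]], so it has at least two edges, and closing it with that edge gives a
   cycle of length at least 3. *)
have sz : (2 <= size p)%N.
  case: p q upq lp => [|a [|b p]] //= q _ l; subst.
  by move: q; rewrite andbT => /asboolP[].
exists (size p).-2.
have Esz : (size p).-2.+3 = (size p).+1 by case: (size p) sz => [|[]].
exists (fun i => nth (x : E) ((x : E) :: p) i); split.
  move=> i j E0; apply/val_inj/eqP.
  rewrite -(nth_uniq (x : E) _ _ upq) /= -?Esz ?ltn_ord //.
  exact/eqP.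
case=> k /=; rewrite Esz ltnS leq_eqVlt => /predU1P[->|kp].
  by move: lp; rewrite modnn (last_nth (x : E)) setUC => ->.
rewrite modn_small //; by move/pathP : q => /(_ x k kp)/asboolP[].
Qed.

(** * Bases: edge sets of maximal forests *)

Lemma adj_neq (H : graph) (x y : H) : adj x y -> x <> y.
Proof. by move=> xy E; move: xy; rewrite E; exact: adj_irr. Qed.

(** Maximality is replaced by a local spanning condition, which makes sense for disconnected and
    infinite graphs alike. *)
Definition base (H : graph) (B : set (set H)) : Prop :=
  [/\ B `<=` edges H, forest B & forall x y, adj x y -> conn B x y].

Section Bases.
Variable H : graph.
Implicit Types (A B T : set (set H)) (x y : H).

Lemma base_maximal A B :
  base B -> A `<=` edges H -> forest A -> B `<=` A -> A = B.
Proof.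
move=> [_ _ cB] AE fA BA; apply/seteqP; split=> // e Ae.
have [x [y [xy ee]]] := AE _ Ae; subst e.
apply: contrapT => nB; apply: (fA _ _ Ae); apply: conn_sub (cB _ _ xy) => g Bg.
by split; [exact: BA|move=> gxy; apply: nB; rewrite -gxy].
Qed.

Lemma maximal_base B : B `<=` edges H -> forest B ->
  (forall A, A `<=` edges H -> forest A -> B `<=` A -> A = B) -> base B.
Proof.
move=> BE fB maxB; split=> // x y xy; apply: contrapT => nc.
apply: (nc); apply: conn1.
rewrite -(maxB (B `|` [set [set x; y]])); first by right.
- by move=> e [/BE//|->]; apply/edgesP.
- exact: forest_add.
- by move=> e; left.
Qed.

Lemma exists_base : exists B, base B.
Proof.
pose P B := B `<=` edges H /\ forest B.
have [F FP Ftot|B [[BE fB] Bmax]] := @Zorn_bigcup (set H) P; last first.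
  exists B; apply: maximal_base => // A AE fA BA.
  apply: contrapT => AB; apply: (Bmax A) => //; split=> // AB'.
  by apply: AB; apply/seteqP.
split; first by move=> e [X /FP[XE _] /XE].
move=> x y [X FX Xxy] c.
(* Zorn's lemma needs unions of chains to be forests: a detour around an edge uses finitely many
   edges, so one member of the chain contains all of them. *)
suff [Y [FY XY {}c]] : exists Y, [/\ F Y, X `<=` Y &
    conn (Y `\ [set x; y]) x y].
  by have [_ fY] := FP _ FY; apply: fY c; exact: XY.
move: c; move: {Xxy}[set x; y] => e.
elim=> [|t u _ [Y [FY XY c]] [[Z FZ Ztu] ne]].
  by exists X; split=> //; exact: conn0.
have [YZ|ZY] := Ftot _ _ FY FZ.
- exists Z; split=> //; first exact: subset_trans YZ.
  apply: (@connS _ _ _ t); last by split.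
  by apply: conn_sub c => g [/YZ ? ?]; split.
- exists Y; split=> //; apply: (connS c); split=> //; exact: ZY.
Qed.

Definition exchangeable T e f : Prop :=
  [/\ T e, ~ T f & base ((T `\ e) `|` [set f])].

(** Removing [e] separates [x] from [y], so adding [[set x; y]] closes no cycle. The walk from [x]
    to [y] in [T] crosses [e]; its two halves and the new edge reconnect the ends of [e]. *)
Lemma base_exchange T e x y : base T -> adj x y -> T e -> ~ T [set x; y] ->
  ~ conn (T `\ e) x y -> exchangeable T e [set x; y].
Proof.
move=> [TE fT cT] xy Te nT nc; split=> //; split.
- by move=> g [[/TE]|->] //; apply/edgesP.
- by apply: forest_add => //; apply: forest_sub fT => g [].
have [a [b [ab ee]]] := TE _ Te; subst e => c d /cT.
apply: conn_bind => {}c {}d Tcd.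
have [E|ne] := pselect ([set c; d] = [set a; b]); last first.
  by apply: conn1; left.
suff cab : conn (T `\ [set a; b] `|` [set [set x; y]]) a b.
  by case: (set2_eq E) => -[-> ->] //; exact: conn_sym.
have s : T `\ [set a; b] `<=` T `\ [set a; b] `|` [set [set x; y]].
  by move=> g; left.
have : conn (T `\ [set a; b] `|` [set [set a; b]]) x y.
  apply: conn_sub (cT _ _ xy) => g Tg.
  by have [->|ne] := pselect (g = [set a; b]); [right|left].
have cxy : conn (T `\ [set a; b] `|` [set [set x; y]]) x y.
  by apply: conn1; right.
move=> c'; case: (conn_add c') => [//|[/(conn_sub s) xa /(conn_sub s) yb]|
    [/(conn_sub s) xb /(conn_sub s) ya]].
  apply: conn_trans (conn_sym xa) _; apply: conn_trans cxy _.
  exact: conn_sym.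
by apply: conn_trans ya _; apply: conn_trans (conn_sym cxy) xb.
Qed.

Lemma base_two_exchanges T f : base T -> edges H f -> ~ T f ->
  exists e e', [/\ e <> e', exchangeable T e f & exchangeable T e' f].
Proof.
move=> bT [x [y [xy ->]]] nT; have [TE fT cT] := bT.
have nxy := adj_neq xy.
have [e [e' [ee Te Te' ne ne']]] := forest_two_edges fT (cT _ _ xy) nxy nT.
by exists e, e'; split=> //; exact: base_exchange.
Qed.

(** A base without [f] lies in [T]; one with [f] omits some [e] of [T] and lies in [T - e + f]. One
    base never properly contains another. *)
Lemma unicyclic_base T f B : base T -> edges H `<=` T `|` [set f] ->
  edges H f -> ~ T f -> base B ->
  B = T \/ exists2 e, exchangeable T e f & B = (T `\ e) `|` [set f].
Proof.
move=> bT Hf Ef nTf bB; have [TE fT cT] := bT; have [BE fB cB] := bB.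
have [Bf|nBf] := pselect (B f); last first.
  left; symmetry; apply: base_maximal bB _ _ _ => // e Be.
  by case: (Hf e (BE _ Be)) => // ef; case: nBf; rewrite -ef.
right; have [x [y [xy ef]]] := Ef; subst f.
have [TB|/existsNP[e /not_implyP[Te nBe]]] := pselect (T `<=` B).
  by case: nTf; rewrite -(base_maximal bT BE fB TB).
have BT : B `<=` (T `\ e) `|` [set [set x; y]].
  move=> g Bg; case: (Hf _ (BE _ Bg)) => [Tg|->]; [left|by right].
  by split=> // ge; apply: nBe; rewrite -ge.
have exch : exchangeable T e [set x; y].
  (* If [T - e] still connected [x] to [y], it would connect whatever [B] connects, in particular
     the ends of [e], against [T] being a forest. *)
  apply: base_exchange => // cxy.
  have [a [b [ab ee]]] := TE _ Te; subst e; apply: (fT _ _ Te).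
  have := conn_sub BT (cB _ _ ab); apply: conn_bind => c d [Tcd|E].
    exact: conn1.
  by case: (set2_eq E) => -[-> ->] //; exact: conn_sym.
exists e => //; have [_ _ [E1 E2 _]] := exch.
by symmetry; apply: base_maximal bB _ _ _.
Qed.

Lemma base_triangle B x y z : base B -> adj x y -> adj y z -> adj x z ->
  [\/ ~ B [set x; y], ~ B [set y; z] | ~ B [set x; z]].
Proof.
move=> [_ fB _] xy yz xz; apply: contrapT => nB.
have Bxy : B [set x; y] by apply: contrapT => ?; apply: nB; constructor 1.
have Byz : B [set y; z] by apply: contrapT => ?; apply: nB; constructor 2.
have Bxz : B [set x; z] by apply: contrapT => ?; apply: nB; constructor 3.
apply: (fB _ _ Bxy).
have [[nxy nyz] nxz] := (adj_neq xy, adj_neq yz, adj_neq xz).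
apply: (@connS _ _ _ z); first apply: conn1.
  by split=> // E; case: (set2_eq E) => -[? ?]; auto.
rewrite setUC in Byz; split=> // E; case: (set2_eq E) => -[? ?]; auto.
Qed.

End Bases.

(** * The forest graph described by bases *)

Section ForestGraph.
Variable H : graph.
Implicit Types (F : forest_graph H) (B : set (set H)).

Lemma subgraph_eq (S S' : subgraph H) : sub_vertices S = sub_vertices S' ->
  sub_edges S = sub_edges S' -> S = S'.
Proof.
case: S S' => [V E EP EV] [V' E' EP' EV'] /= EqV EqE; subst V' E'.
by congr Subgraph.
Qed.

Lemma edge_subT B (e : set H) : B e -> e `<=` setT. Proof. by []. Qed.

Definition spanning B (BE : B `<=` edges H) : subgraph H :=
  @Subgraph H setT B BE (@edge_subT B).

(** Adding isolated vertices to a forest creates no cycle, so a maximal forest contains every vertex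
    and is determined by its edges. *)
Lemma maximal_forest_base (S : subgraph H) :
  maximal_forest S -> sub_vertices S = setT /\ base (sub_edges S).
Proof.
move=> [aS maxS].
have fS := acyclic_forest aS.
have max A (AE : A `<=` edges H) :
    forest A -> sub_edges S `<=` A -> spanning AE = S.
  by move=> fA SA; apply: maxS; [exact: forest_acyclic|split].
split; first by rewrite -(max _ (@sub_edgesP _ S)).
apply: maximal_base => [|//|A AE fA SA]; first exact: sub_edgesP.
by rewrite -(max A AE).
Qed.

Lemma base_maximal_forest B (BE : B `<=` edges H) :
  base B -> maximal_forest (spanning BE).
Proof.
move=> bB; have [_ fB _] := bB; split; first exact: forest_acyclic.
move=> S /acyclic_forest fS [VS ES]; apply: subgraph_eq => /=.
  by apply/seteqP; split.
by apply: base_maximal => //; exact: sub_edgesP.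
Qed.

Definition forest_edges F : set (set H) := sub_edges (sval F).

Lemma forest_edges_base F : base (forest_edges F).
Proof. by case: (maximal_forest_base (svalP F)). Qed.

Lemma forest_edges_inj : injective forest_edges.
Proof.
move=> [S mS] [S' mS'] /= E; apply: eq_exist; apply: subgraph_eq => //.
by case: (maximal_forest_base mS) (maximal_forest_base mS') => -> _ [-> _].
Qed.

Lemma forest_edges_surj B : base B -> exists F, forest_edges F = B.
Proof.
move=> bB; have [BE _ _] := bB.
by exists (exist _ _ (base_maximal_forest BE bB)).
Qed.

Lemma forest_adjP F F' : adj F F' <-> exists e f,
  [/\ forest_edges F e, ~ forest_edges F f &
      forest_edges F' = (forest_edges F `\ e) `|` [set f]].
Proof.
split=> [[e [f [Fe Ff _ E]]]|[e [f [Fe Ff E]]]]; exists e, f; split=> //.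
by case: (maximal_forest_base (svalP F)) (maximal_forest_base (svalP F'))
  => -> _ [-> _].
Qed.

Lemma exchangeable_adj F F' e f : exchangeable (forest_edges F) e f ->
  forest_edges F' = (forest_edges F `\ e) `|` [set f] -> adj F F'.
Proof. by move=> [Fe Ff _] EF'; apply/forest_adjP; exists e, f. Qed.

(** [F2] is [F1 - e2 + e1]. This is the third side of the triangle formed by [F], [F1] and [F2]. *)
Lemma exchangeable_adj2 F F1 F2 e1 e2 f : e1 <> e2 ->
  exchangeable (forest_edges F) e1 f -> exchangeable (forest_edges F) e2 f ->
  forest_edges F1 = (forest_edges F `\ e1) `|` [set f] ->
  forest_edges F2 = (forest_edges F `\ e2) `|` [set f] -> adj F1 F2.
Proof.
move=> e12 [Fe1 Ff _] [Fe2 _ _] E1 E2; apply/forest_adjP; exists e2, e1.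
have e1f : e1 <> f by move=> E; apply: Ff; rewrite -E.
have e2f : e2 <> f by move=> E; apply: Ff; rewrite -E.
rewrite E1 E2; split.
- by left; split=> // E; apply: e12.
- by case=> [[_ /(_ erefl)]|/e1f].
apply/seteqP; split=> g /=.
  case=> [[Fg ge2]|->]; last by left; split; [right|move=> E; apply: e2f].
  by have [->|ge1] := pselect (g = e1); [right|left; split=> //; left].
case=> [[[[Fg _]|->] ge2]|->]; [by left|by right|by left].
Qed.

End ForestGraph.

(** * Growth of the number of edges missed by a base *)

(** A lower bound on the number of missed edges that makes sense in infinite graphs; only the values
    of [g] below [k] matter. *)
Definition misses (X : graph) (k : nat) (B : set (set X)) : Prop :=
  exists g : nat -> set X,
    (forall i j, (i < k)%N -> (j < k)%N -> g i = g j -> i = j) /\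
    (forall i, (i < k)%N -> edges X (g i) /\ ~ B (g i)).

Lemma missesW (X : graph) (k l : nat) (B : set (set X)) :
  (k <= l)%N -> misses l B -> misses k B.
Proof.
move=> kl [g [gI gB]]; exists g; split=> [i j ik jk|i ik]; last first.
  exact/gB/(leq_trans ik).
by apply: gI; [exact: leq_trans ik _|exact: leq_trans jk _].
Qed.

Lemma misses2 (X : graph) (B : set (set X)) (e f : set X) : e <> f ->
  edges X e -> edges X f -> ~ B e -> ~ B f -> misses 2 B.
Proof.
move=> ef Xe Xf Be Bf; exists (fun i => if i is 0 then e else f); split.
  by move=> [|[|i]] [|[|j]] // _ _ E; case: ef.
by case=> [|[|i]].
Qed.

Lemma triangle_misses (X : graph) (B : set (set X)) (x y z : X) : base B ->
  adj x y -> adj y z -> adj x z ->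
  exists a b, [/\ adj a b, ~ B [set a; b] &
    [\/ a = x /\ b = y, a = y /\ b = z | a = x /\ b = z]].
Proof.
move=> bB xy yz xz; case: (base_triangle bB xy yz xz) => nB.
- by exists x, y; split=> //; constructor 1.
- by exists y, z; split=> //; constructor 2.
- by exists x, z; split=> //; constructor 3.
Qed.

(** One triangle of the K_4 gives a missed edge [[set p; q]]; the triangle on [p] and the two
    vertices other than [q] avoids that edge and gives a second one. *)
Lemma K4_misses2 (X : graph) (B : set (set X)) (w x y z : X) : base B ->
  adj w x -> adj w y -> adj w z -> adj x y -> adj x z -> adj y z -> misses 2 B.
Proof.
move=> bB.
have gen (p q r s : X) : adj p q -> adj p r -> adj p s -> adj q r ->
    adj q s -> adj r s -> ~ B [set p; q] -> misses 2 B.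
  move=> pq pr ps qr qs rs npq.
  have [a [b [ab nB cases]]] := triangle_misses bB pr rs ps.
  apply: (misses2 _ _ _ npq nB); rewrite ?edgesP //.
  move: (adj_neq pq) (adj_neq pr) (adj_neq ps) (adj_neq qr) (adj_neq qs).
  move=> ? ? ? ? ? E.
  by case: cases => -[? ?]; subst; case: (set2_eq E) => -[? ?]; subst.
move=> wx wy wz xy xz yz.
have [xw yw yx] := And3 (adj_sym wx) (adj_sym wy) (adj_sym xy).
have [a [b [_ nB [] [? ?]]]] := triangle_misses bB wx xy wy; subst a b.
- exact: (gen w x y z).
- exact: (gen x y w z).
- exact: (gen w y x z).
Qed.

(* The [k] triangles through [T] spanned by the exchanges that add a missed
   edge [f i] are edge-disjoint, since only the [i]-th one has a vertex
   containing [f i]. One more triangle, through [T - e + f 0] and adding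
   [f 1], is disjoint from them: each of its edges sees both [f 0] and [f 1]. *)
Lemma forest_graph_misses (H : graph) (T : set (set H)) (k : nat) :
  base T -> (1 < k)%N -> misses k T ->
  forall S : set (set (forest_graph H)), base S -> misses k.+1 S.
Proof.
move=> bT k1 [f [fI fT]] S bS.
have [F0 EF0] := forest_edges_surj bT.
have key i : exists g, (i < k)%N -> [/\ edges (forest_graph H) g, ~ S g,
    exists2 F, g F & forest_edges F (f i) &
    forall j F, (j < k)%N -> g F -> forest_edges F (f j) -> j = i].
  have [ik|_] := ltnP i k; last by exists set0.
  have [fE fnT] := fT i ik.
  have [e1 [e2 [e12 ex1 ex2]]] := base_two_exchanges bT fE fnT.
  have [_ _ b1] := ex1; have [_ _ b2] := ex2.
  have [F1 EF1] := forest_edges_surj b1; have [F2 EF2] := forest_edges_surj b2.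
  rewrite -EF0 in ex1 ex2 EF1 EF2.
  have [a [b [ab nS cases]]] := triangle_misses bS (exchangeable_adj ex1 EF1)
    (exchangeable_adj2 e12 ex1 ex2 EF1 EF2) (exchangeable_adj ex2 EF2).
  exists [set a; b] => _; split=> //; first exact/edgesP.
    (* Whichever side is missed, [b] is [F1] or [F2], which contain [f i], while [F0] contains no
       [f j]. *)
    exists b; first by right.
    by case: cases => -[_ ->]; rewrite ?EF1 ?EF2; right.
  have only j F : (j < k)%N -> [\/ F = F0, F = F1 | F = F2] ->
      forest_edges F (f j) -> j = i.
    move=> jk; have [_ fjT] := fT j jk; rewrite -EF0 in fjT.
    case=> ->; rewrite ?EF1 ?EF2 //; by [case=> [[]//|/fI]; exact].
  move=> j F jk gF; apply: only => //.
  by case: cases gF => -[-> ->] [] /= ->;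
    by [constructor 1|constructor 2|constructor 3].
have [g gP] := choice key.
have [f0E f0T] := fT 0 (ltnW k1); have [f1E f1T] := fT 1 k1.
have f01 : f 0 <> f 1 by move=> /(fI _ _ (ltnW k1) k1).
have [e [_ [_ [Te _ b1] _]]] := base_two_exchanges bT f0E f0T.
have [F1 EF1] := forest_edges_surj b1.
have F1f0 : forest_edges F1 (f 0) by rewrite EF1; right.
have nF1f1 : ~ forest_edges F1 (f 1).
  by rewrite EF1 => -[[]//|E]; apply: f01.
have [a [a' [aa' ex ex']]] :=
  base_two_exchanges (forest_edges_base F1) f1E nF1f1.
have [_ _ ba] := ex; have [_ _ ba'] := ex'.
have [A EA] := forest_edges_surj ba; have [A' EA'] := forest_edges_surj ba'.
have [c [d [cd nS cases]]] := triangle_misses bS (exchangeable_adj ex EA)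
  (exchangeable_adj2 aa' ex ex' EA EA') (exchangeable_adj ex' EA').
have has1 : forest_edges d (f 1).
  by case: cases => -[_ ->]; rewrite ?EA ?EA'; right.
(* [F1] contains [f 0], and an exchange out of [F1] loses it only by removing [f 0] itself; as [a]
   and [a'] differ, at most one of [A] and [A'] lacks it. *)
have has0 : forest_edges c (f 0) \/ forest_edges d (f 0).
  case: cases => -[-> ->]; [by left| |by left].
  rewrite EA EA'; have [a0|na0] := pselect (f 0 = a).
    by right; left; split=> // E; apply: aa'; rewrite -a0 -E.
  by left; left; split.
(* An edge [g i] sees only the index [i], but this one sees both 0 and 1. *)
have new i : (i < k)%N -> g i <> [set c; d].
  move=> ik E; have [_ _ _ only] := gP i ik; rewrite E in only.
  have i1 : 1 = i by apply: (only _ d) => //; right.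
  have i0 : 0 = i.
    by case: has0; apply: only; [exact: ltnW|left|exact: ltnW|right].
  by rewrite -i0 in i1.
exists (fun i => if (i < k)%N then g i else [set c; d]); split; last first.
  move=> i; rewrite ltnS => ik.
  have [{}ik|_] := ltnP i k; first by have [? ? _ _] := gP i ik.
  by split=> //; exact/edgesP.
move=> i j; rewrite !ltnS => ik jk.
have [{}ik|ki] := ltnP i k; have [{}jk|kj] := ltnP j k.
- move=> E; have [_ _ [F gF Ff] _] := gP i ik; have [_ _ _ only] := gP j jk.
  by apply: (only _ F) => //; rewrite -E.
- by move=> /new; case.
- by move=> /esym/new; case.
- by move=> _; apply/eqP; rewrite eqn_leq (leq_trans ik kj) (leq_trans jk ki).
Qed.

(** Each missed edge [f i] yields a base [T - e + f i], and these are distinct because [f i] is the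
    only listed missed edge in it. Growth of missed edges thus becomes growth of vertices. *)
Lemma forest_graph_card (H : graph) (T : set (set H)) (k : nat) :
  base T -> misses k T -> exists h : nat -> forest_graph H,
    forall i j, (i < k)%N -> (j < k)%N -> h i = h j -> i = j.
Proof.
move=> bT [f [fI fT]]; have [F0 EF0] := forest_edges_surj bT.
have key i : exists F, (i < k)%N -> forest_edges F (f i) /\
    forall j, (j < k)%N -> forest_edges F (f j) -> j = i.
  have [ik|_] := ltnP i k; last by exists F0.
  have [fE fnT] := fT i ik.
  have [e [_ [_ [_ _ b] _]]] := base_two_exchanges bT fE fnT.
  have [F EF] := forest_edges_surj b; exists F => _.
  rewrite EF; split; first by right.
  by move=> j jk [[/(fT j jk).2]//|/fI]; exact.
have [h hP] := choice key; exists h => i j ik jk E.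
by apply: (hP j jk).2 => //; rewrite -E; apply: (hP i ik).1.
Qed.

(** * The exceptional graphs K_1 and K_3 *)

Lemma isomorphic_sym (G H : graph) : isomorphic G H -> isomorphic H G.
Proof.
move=> [f [[g fK gK] fadj]]; exists g; split; first by exists f.
by move=> x y; rewrite fadj !gK.
Qed.

Lemma isomorphic_trans (G H K : graph) :
  isomorphic G H -> isomorphic H K -> isomorphic G K.
Proof.
move=> [f [fB fadj]] [g [gB gadj]]; exists (g \o f); split.
  exact: bij_comp.
by move=> x y; rewrite fadj gadj.
Qed.

Lemma isomorphic_complete (X : graph) (n : nat) (g : 'I_n -> X) :
  (forall x, exists i, g i = x) -> (forall i j, i <> j -> adj (g i) (g j)) ->
  isomorphic X (complete_graph n).
Proof.
move=> gS gadj; have [h hK] := choice gS.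
have gI : injective g.
  move=> i j E; apply: contrapT => /gadj; rewrite E; exact: adj_irr.
exists h; split; first by exists g => // i; apply: gI.
move=> x y /=; split=> [xy E|ne]; last by rewrite -(hK x) -(hK y); exact: gadj.
by apply: (adj_neq xy); rewrite -(hK x) -(hK y) E.
Qed.

Lemma isomorphic_K1 (X : graph) (x : X) :
  (forall y, y = x) -> isomorphic X (complete_graph 1).
Proof.
move=> Xx; apply: (@isomorphic_complete _ _ (fun=> x)).
  by move=> y; exists ord0; rewrite (Xx y).
by move=> i j; rewrite !ord1.
Qed.

Lemma isomorphic_K3 (X : graph) (x y z : X) : adj x y -> adj y z -> adj x z ->
  (forall t, [\/ t = x, t = y | t = z]) -> isomorphic X (complete_graph 3).
Proof.
move=> xy yz xz all.
have [yx zy zx] := And3 (adj_sym xy) (adj_sym yz) (adj_sym xz).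
pose g (i : 'I_3) := match val i with 0 => x | 1 => y | _ => z end.
apply: (@isomorphic_complete _ _ g).
  move=> t; case: (all t) => ->.
  - by exists (@Ordinal 3 0 isT).
  - by exists (@Ordinal 3 1 isT).
  - by exists (@Ordinal 3 2 isT).
move=> [[|[|[|i]]] ip] [[|[|[|j]]] jp] ne //; by case: ne; exact: val_inj.
Qed.

Lemma forest_graph_acyclic (H : graph) (T : set (set H)) :
  base T -> edges H `<=` T -> isomorphic (forest_graph H) (complete_graph 1).
Proof.
move=> bT HT; have [F0 EF0] := forest_edges_surj bT.
apply: (@isomorphic_K1 _ F0) => F; apply: forest_edges_inj; rewrite EF0.
have [TE fT _] := bT; have [FE _ _] := forest_edges_base F.
symmetry; apply: base_maximal => //; first exact: forest_edges_base.
exact: subset_trans FE HT.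
Qed.

(** The edges exchangeable with [f] are the other edges of the cycle in [T + f], so the hypotheses
    describe a single cycle, of length 3. The bases are [T] and its two exchanges, pairwise
    adjacent. *)
Lemma forest_graph_unicyclic (H : graph) (T : set (set H)) (f e1 e2 : set H) :
  base T -> edges H `<=` T `|` [set f] -> edges H f -> e1 <> e2 ->
  exchangeable T e1 f -> exchangeable T e2 f ->
  (forall e, exchangeable T e f -> e = e1 \/ e = e2) ->
  isomorphic (forest_graph H) (complete_graph 3).
Proof.
move=> bT Hf Ef e12 ex1 ex2 only; have [_ nf b1] := ex1; have [_ _ b2] := ex2.
have [F0 EF0] := forest_edges_surj bT.
have [F1 EF1] := forest_edges_surj b1; have [F2 EF2] := forest_edges_surj b2.
rewrite -EF0 in ex1 ex2 EF1 EF2.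
apply: (isomorphic_K3 (exchangeable_adj ex1 EF1)
  (exchangeable_adj2 e12 ex1 ex2 EF1 EF2) (exchangeable_adj ex2 EF2)) => F.
have [EF|[e ex EF]] := unicyclic_base bT Hf Ef nf (forest_edges_base F).
  by constructor 1; apply: forest_edges_inj; rewrite EF.
rewrite -EF0 in EF.
have [ee|ee] := only e ex; subst e.
  by constructor 2; apply: forest_edges_inj; rewrite EF.
by constructor 3; apply: forest_edges_inj; rewrite EF.
Qed.

(** The value 2 is the threshold from which [forest_graph_misses] can be iterated. *)
Lemma forest_graph_trichotomy (H : graph) :
  [\/ isomorphic (forest_graph H) (complete_graph 1),
      isomorphic (forest_graph H) (complete_graph 3) |
      forall S : set (set (forest_graph H)), base S -> misses 2 S].
Proof.
have [T bT] := exists_base H.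
have [HT|/existsNP[f /not_implyP[Ef nf]]] := pselect (edges H `<=` T).
  by constructor 1; exact: forest_graph_acyclic HT.
have [Hf|/existsNP[f' /not_implyP[Ef' nf']]] :=
  pselect (edges H `<=` T `|` [set f]); last first.
  constructor 3 => S bS; apply: (@missesW _ _ 3) => //.
  apply: (forest_graph_misses bT) bS => //.
  by apply: (misses2 _ Ef Ef') => // [ff'|Tf']; apply: nf'; [right|left].
have [e1 [e2 [e12 ex1 ex2]]] := base_two_exchanges bT Ef nf.
(* A third exchangeable edge means a cycle of length at least 4; [T] and three exchanges adding [f]
   then span a K_4. *)
have [only|/existsNP[e3 /not_implyP[ex3 /not_orP[e31 e32]]]] :=
  pselect (forall e, exchangeable T e f -> e = e1 \/ e = e2).
  by constructor 2; exact: forest_graph_unicyclic only.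
constructor 3 => S bS.
have [[_ _ b1] [_ _ b2] [_ _ b3]] := And3 ex1 ex2 ex3.
have [F0 EF0] := forest_edges_surj bT; have [F1 EF1] := forest_edges_surj b1.
have [F2 EF2] := forest_edges_surj b2; have [F3 EF3] := forest_edges_surj b3.
rewrite -EF0 in ex1 ex2 ex3 EF1 EF2 EF3.
apply: (@K4_misses2 _ _ F0 F1 F2 F3) => //.
- exact: exchangeable_adj EF1.
- exact: exchangeable_adj EF2.
- exact: exchangeable_adj EF3.
- exact: exchangeable_adj2 EF1 EF2.
- by apply: exchangeable_adj2 EF1 EF3 => // E; apply: e31.
- by apply: exchangeable_adj2 EF2 EF3 => // E; apply: e32.
Qed.

Lemma forest_graph_K1 (X : graph) :
  isomorphic X (complete_graph 1) ->
  isomorphic (forest_graph X) (complete_graph 1).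
Proof.
move=> [f [_ fadj]]; have [T bT] := exists_base X.
apply: (forest_graph_acyclic bT) => e [x [y [/fadj]]] /=.
by rewrite !ord1.
Qed.

Lemma forest_graph_K3 (X : graph) :
  isomorphic X (complete_graph 3) ->
  isomorphic (forest_graph X) (complete_graph 3).
Proof.
move=> /isomorphic_sym[g [[h hK gK] gadj]].
pose o (i : nat) (i3 : (i < 3)%N) := @Ordinal 3 i i3.
pose x := g (@o 0 isT); pose y := g (@o 1 isT); pose z := g (@o 2 isT).
have xy : adj x y by apply/gadj.
have yz : adj y z by apply/gadj.
have xz : adj x z by apply/gadj.
have allv t : [\/ t = x, t = y | t = z].
  rewrite -(gK t); case: (h t) => [[|[|[|i]]] ip] //.
  - by constructor 1; congr g; exact: val_inj.
  - by constructor 2; congr g; exact: val_inj.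
  - by constructor 3; congr g; exact: val_inj.
have alle e : edges X e ->
    [\/ e = [set x; y], e = [set y; z] | e = [set x; z]].
  move=> [a [b [/adj_neq ab ->]]].
  case: (allv a) (allv b) ab => -> [] -> ab;
    by [case: ab|constructor 1|constructor 2|constructor 3
       |constructor 1; rewrite setUC|constructor 2; rewrite setUC
       |constructor 3; rewrite setUC].
have [T bT] := exists_base X.
have [a [b [/edgesP Ef nf _]]] := triangle_misses bT xy yz xz.
set f := [set a; b] in Ef nf *.
have [e1 [e2 [e12 ex1 ex2]]] := base_two_exchanges bT Ef nf.
have [[Te1 _ _] [Te2 _ _]] := (ex1, ex2); have [TE _ _] := bT.
have fe1 : f <> e1 by move=> E; apply: nf; rewrite E.
have fe2 : f <> e2 by move=> E; apply: nf; rewrite E.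
have all3 e : edges X e -> [\/ e = f, e = e1 | e = e2].
  move=> /alle ce; have cf := alle _ Ef.
  have ce1 := alle _ (TE _ Te1); have ce2 := alle _ (TE _ Te2).
  (* Once the three sides are abstracted, it remains that [f], [e1], [e2] are distinct members of a
     list of three, hence exhaust it. *)
  move: [set x; y] [set y; z] [set x; z] ce cf ce1 ce2 => xy' yz' xz'.
  case=> -> [] ? [] ? [] ?; subst;
    first [by constructor 1|by constructor 2|by constructor 3|congruence].
apply: (forest_graph_unicyclic bT _ Ef e12 ex1 ex2).
  by move=> e /all3[->|->|->]; [right|left|left].
move=> e [Te _ _]; case: (all3 e (TE _ Te)); auto.
by move=> E; case: nf; rewrite -E.
Qed.

(** * Iterated forest graphs and the depth *)

Lemma forest_iter_trichotomy (H : graph) (n : nat) :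
  [\/ isomorphic (forest_iter n.+1 H) (complete_graph 1),
      isomorphic (forest_iter n.+1 H) (complete_graph 3) |
      forall S : set (set (forest_iter n.+1 H)), base S -> misses n.+2 S].
Proof.
elim: n => [|n [K1|K3|IH]]; first exact: forest_graph_trichotomy.
- by constructor 1; exact: forest_graph_K1.
- by constructor 2; exact: forest_graph_K3.
constructor 3; have [T bT] := exists_base (forest_iter n.+1 H).
exact: (forest_graph_misses bT _ (IH T bT)).
Qed.

Lemma finite_graph_bound (G : graph) : finite_graph G -> exists N : nat,
  forall k (h : nat -> G),
    (forall i j, (i < k)%N -> (j < k)%N -> h i = h j -> i = j) -> (k <= N)%N.
Proof.
move=> /finite_setP[N GN]; exists N => k h hI; rewrite -card_le_II.
have hI' : {in `I_k &, injective h} by move=> i j; rewrite !inE; exact: hI.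
rewrite -(card_le_eql (inj_card_eq hI')) -(card_le_eqr GN).
exact: subset_card_le.
Qed.

Lemma forest_iter_bound (G : graph) : finite_graph G -> exists N : nat,
  forall n H, (N < n)%N -> isomorphic G (forest_iter n H) ->
  isomorphic G (complete_graph 1) \/ isomorphic G (complete_graph 3).
Proof.
(* Exceeding [N.+1] forces at least two iterations, so [G] is the forest graph of a graph that is
   itself a forest graph, whose missed edges can be counted. *)
move=> /finite_graph_bound[N bound]; exists N.+1 => -[|[|n]] // H Nn GH.
have [K1|K3|IH] := forest_iter_trichotomy H n.+1.
- by left; exact: isomorphic_trans K1.
- by right; exact: isomorphic_trans K3.
have [K1|K3|{}IH] := forest_iter_trichotomy H n.
- by left; apply: isomorphic_trans GH _; exact: forest_graph_K1.
- by right; apply: isomorphic_trans GH _; exact: forest_graph_K3.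
have [T bT] := exists_base (forest_iter n.+1 H).
have [h hI] := forest_graph_card bT (IH T bT).
have [f [[f' fK f'K] _]] := isomorphic_sym GH.
suff : (n.+2 <= N)%N by rewrite leqNgt (ltnW Nn).
apply: (bound _ (f \o h)) => i j i2 j2 /(can_inj fK); exact: hI.
Qed.

Lemma F_depth_unbounded (G : graph) : F_depth G = +oo%E ->
  forall m : nat, exists n H, (m < n)%N /\ isomorphic G (forest_iter n H).
Proof.
(* The branches with default value 0 are not infinite. In the remaining one, a bound [m] on the
   iteration counts would be an upper bound below the supremum. *)
rewrite /F_depth; case: asboolP => // _; rewrite /supremum.
case: ifP => // _; case: xgetP => // y _ [_ lb] yoo m; rewrite {}yoo in lb.
apply: contrapT => nex; have := lb (Posz m)%:E.
have /[swap]/[apply] : ubound [set (Posz n)%:E | n in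
    [set n | exists H, isomorphic G (forest_iter n H)]] (Posz m)%:E.
  move=> _ [n [H GH] <-]; rewrite lee_fin lez_nat leqNgt; apply/negP => mn.
  by apply: nex; exists n, H.
by [].
Qed.

Lemma unbounded_F_depth (G : graph) :
  (forall n, exists H, isomorphic G (forest_iter n H)) -> F_depth G = +oo%E.
Proof.
move=> all; rewrite /F_depth; case: asboolP => [_|]; last first.
  by have [H /isomorphic_sym GH] := all 1%N; case; exists H.
rewrite /supremum; case: ifPn => [/eqP E|_].
  suff : (set0 : set (\bar int)) (Posz 0)%:E by case.
  by rewrite -E; exists 0%N => //; exact: all.
apply: xget_subset1; last exact: is_subset1_supremums.
split=> [x _|x ub]; first exact: leey.
have {}ub n : ((Posz n)%:E <= x)%E by apply: ub; exists n => //; exact: all.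
(* A finite upper bound [r] is beaten by the natural number [|r| + 1]. *)
case: x ub => [r|//|/(_ 0%N)//] /(_ `|r|.+1%N).
rewrite lee_fin => /Order.POrderTheory.le_trans/(_ (lez_abs r)).
by rewrite lez_nat ltnn.
Qed.

(** The hypothesis ranges over all copies of [K], so the induction does not need [forest_graph] to
    respect isomorphism in general. *)
Lemma forest_iter_fixed (K : graph) (n : nat) :
  (forall X, isomorphic X K -> isomorphic (forest_graph X) K) ->
  isomorphic (forest_iter n K) K.
Proof.
move=> fixK; elim: n => [|n IH]; last exact: fixK.
by exists id; split=> //; exists id.
Qed.

Theorem theorem6p1 (G : graph) (finG : finite_graph G) :
  F_depth G = +oo%E <->
  isomorphic G (complete_graph 1) \/ isomorphic G (complete_graph 3).
Proof.
split=> [/F_depth_unbounded unb|GK].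
  have [N bound] := forest_iter_bound finG.
  by have [n [H [Nn GH]]] := unb N; exact: bound GH.
apply: unbounded_F_depth => n.
case: GK => GK; [exists (complete_graph 1)|exists (complete_graph 3)].
  apply: isomorphic_trans GK _; apply/isomorphic_sym/forest_iter_fixed.
  exact: forest_graph_K1.
apply: isomorphic_trans GK _; apply/isomorphic_sym/forest_iter_fixed.
exact: forest_graph_K3.
Qed.
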